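(* Let $p$ be a prime, $n\ge 1$, $x_0,a_0,a_1,\ldots,a_n\in\mathbb{Q}_p$ with $a_n\neq 0$, and $r\in\mathbb{Z}$. Then $$\left|\int_{|x-x_0|\le p^r}\chi(a_0+a_1x+\dots+a_nx^n)\,dx\right|\le\frac{2p^{n}}{|a_n|^{1/n}}.$$
   Context: $|\cdot|$ denotes the $p$-adic absolute value on $\mathbb{Q}_p$. Every nonzero $x\in\mathbb{Q}_p$ has a unique standard expansion $x=\sum_{j=k}^\infty x_jp^j$ with $x_j\in\{0,\ldots,p-1\}$, $x_k\neq 0$, $|x|=p^{-k}$. The additive character $\chi:\mathbb{Q}_p\to\mathbb{C}$ is $\chi(x)=\exp\!\big(2\pi i\sum_{j=k}^{-1}x_jp^j\big)$ if $|x|>1$ and $\chi(x)=1$ if $|x|\le 1$. $dx$ is the Haar measure on $\mathbb{Q}_p$ normalized so that each ball $\{x:|x-x_0|\le p^r\}$ has measure $p^r$. *)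

(* Defs.v *)
From Stdlib Require Import Reals ZArith Znumtheory List.
Import ListNotations.
Open Scope Z_scope.

(** * p-adic numbers, built from scratch.
    Z_p is the inverse limit of Z/p^N Z: a p-adic integer is a coherent
    sequence u with 0 <= u N < p^N and u N = u (N+1) mod p^N.
    A p-adic number is p^v * u with v : Z and u a p-adic integer, stored in
    normalized form: either u is a unit (u 1 <> 0) or u = 0. *)

Definition pN (p : Z) (N : nat) : Z := p ^ Z.of_nat N.

Definition coherent (p : Z) (u : nat -> Z) : Prop :=
  forall N : nat, 0 <= u N < pN p N /\ u N = u (S N) mod pN p N.

Record Qp (p : Z) := mkQp {
  qv : Z;
  qu : nat -> Z;
  qu_coh : coherent p qu;
  qu_norm : qu 1%nat <> 0 \/ (forall N, qu N = 0)
}.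
Arguments qv {p}. Arguments qu {p}.

Definition Qp_nonzero {p : Z} (x : Qp p) : Prop := exists N, qu x N <> 0.

Definition Qabs {p : Z} (x : Qp p) : R :=
  if qu x 1%nat =? 0 then 0%R else powerRZ (IZR p) (- qv x).

(** Raw (not necessarily normalized) representations (v, u) of p^v * u,
    used for intermediate arithmetic.  All operations are the genuine
    Q_p operations on such representations. *)
Definition raw := (Z * (nat -> Z))%type.

Definition toraw {p : Z} (x : Qp p) : raw := (qv x, qu x).

Definition radd (p : Z) (x y : raw) : raw :=
  let m := Z.min (fst x) (fst y) in
  (m, fun N => (p ^ (fst x - m) * snd x N + p ^ (fst y - m) * snd y N)
                 mod pN p N).

Definition rmul (p : Z) (x y : raw) : raw :=
  (fst x + fst y, fun N => (snd x N * snd y N) mod pN p N).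

Definition rone (p : Z) : raw := (0, fun N => 1 mod pN p N).
Definition rzero : raw := (0, fun _ => 0).

Definition rpow (p : Z) (x : raw) (k : nat) : raw := Nat.iter k (rmul p x) (rone p).

Definition rnat (p v : Z) (j : nat) : raw := (v, fun N => Z.of_nat j mod pN p N).

Definition reval (p : Z) (a : nat -> raw) (n : nat) (x : raw) : raw :=
  fold_right (fun i acc => radd p (rmul p (a i) (rpow p x i)) acc) rzero
             (seq 0 (S n)).

(** The additive character chi(x) = exp(2 pi i {x}_p), where for x = p^v u
    with v < 0 the fractional part sum_{j<0} x_j p^j equals (u mod p^(-v)) / p^(-v),
    and chi(x) = 1 if v >= 0 (then |x| <= 1).  chi_angle is the angle. *)
Definition chi_angle (p : Z) (x : raw) : R :=
  if fst x <? 0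
  then (2 * PI * IZR (snd x (Z.to_nat (- fst x))) / IZR (p ^ (- fst x)))%R
  else 0%R.

Definition Rsum_list (l : list R) : R := fold_right Rplus 0%R l.

(** Haar integral over the ball {x : |x - x0| <= p^r} = x0 + p^(-r) Z_p,
    of the continuous function x |-> chi(f(x)), via Riemann sums:
    int_{ball} g(x) dx = p^r * lim_N p^(-N) sum_{j=0}^{p^N - 1} g(x0 + p^(-r) j).
    Real and imaginary parts: *)
Definition riemann_re (p : Z) (a : nat -> Qp p) (n : nat) (x0 : Qp p) (r : Z)
  (N : nat) : R :=
  (powerRZ (IZR p) r / IZR (pN p N) *
   Rsum_list (map (fun j => cos (chi_angle p
      (reval p (fun i => toraw (a i)) n (radd p (toraw x0) (rnat p (- r) j)))))
      (seq 0 (Z.to_nat (pN p N)))))%R.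

Definition riemann_im (p : Z) (a : nat -> Qp p) (n : nat) (x0 : Qp p) (r : Z)
  (N : nat) : R :=
  (powerRZ (IZR p) r / IZR (pN p N) *
   Rsum_list (map (fun j => sin (chi_angle p
      (reval p (fun i => toraw (a i)) n (radd p (toraw x0) (rnat p (- r) j)))))
      (seq 0 (Z.to_nat (pN p N)))))%R.

(* Main.v *)
(** On the ball, [p ^ K f] takes p-adic integer values for a suitable [K], so the
    integral is [p ^ r] times the mean of [exp (2 pi i P(x) / p ^ K)] over the
    integers [x] modulo [p ^ K], where [P] is an integer polynomial whose leading
    coefficient has known valuation.

    Let [p ^ V] be the content of [P'] and [d] the degree of the reduction of
    [p ^ (-V) P'] modulo [p].  If [K >= V + 3], replacing [x] by
    [x + p ^ (K - V - 1) z] and summing over [z] shows that only residue classes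
    [a] with [P'(a) = 0] modulo [p ^ (V + 1)] contribute.  On such a class,
    [P(a + p y)] has a degree [d_a <= d], and if [d_a = d] then the reduction is
    [c (x - a) ^ d], so that [a] is the only class; hence [sum p ^ d_a <= p ^ d].
    Each of these steps gains a factor [p] and costs [n] in the valuation of the
    leading coefficient, and iterating it gives decay of exponent [1 / n], with
    loss at most [p ^ (n - 1)] from the degrees and [p ^ ((v(n) + 2) / n)] from
    rounding. *)

Require Import Defs.
From Stdlib Require Import Reals ZArith Znumtheory List Lia Lra.
From mathcomp Require all_boot all_order all_algebra zify ssrZ ring Rstruct.

(** The polynomial of the integrand at the point of the ball with parameter [x], once denominators
    are cleared. *)
Definition affine_value (c : nat -> Z) (n : nat) (A B x : Z) : Z :=
  fold_right (fun i acc => c i * (A + B * x) ^ Z.of_nat i + acc) 0 (seq 0 (S n)).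

(* The real-valued functions standing for [k |-> exp (2 pi i k / p^K)]. *)
Definition phase (p : Z) (K : nat) (rho : R) (phi : Z -> R) : Prop :=
  (forall k, (Rabs (phi k) <= rho)%R) /\
  (forall k l, phi (k + pN p K * l) = phi k) /\
  (forall k h, (0 < K)%nat -> ~ (p | h) ->
     Rsum_list (map (fun z => phi (k + pN p (K - 1) * h * Z.of_nat z))
                  (seq 0 (Z.to_nat p))) = 0%R).

Definition phase_sum (p : Z) (phi : Z -> R) (f : Z -> Z) (M : nat) : R :=
  Rsum_list (map (fun j => phi (f (Z.of_nat j))) (seq 0 (Z.to_nat (pN p M)))).

(** * Sums over residue classes of integer polynomials *)

Module PolynomialSums.
Import all_boot all_order all_algebra zify ring.
Set Implicit Arguments.
Unset Strict Implicit.
Unset Printing Implicit Defensive.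
Import Order.TTheory GRing.Theory Num.Theory.
Local Open Scope ring_scope.

(** * Digit splitting and affine substitution *)

Lemma sum_split (R : nmodType) (u v : nat) (F : nat -> R) :
  \sum_(x < u * v) F x = \sum_(i < u) \sum_(j < v) F (i + u * j)%N.
Proof.
elim: v => [|v IH].
  by rewrite muln0 big_ord0 big1 // => i _; rewrite big_ord0.
rewrite mulnS addnC big_split_ord /= IH -big_split /=.
by apply: eq_bigr => i _; rewrite big_ord_recr /= addnC.
Qed.

(** Taylor's formula at [a] over [{poly R}]; normalized derivatives avoid dividing by factorials. *)
Lemma comp_poly_affine (R : comNzRingType) (a b : R) (P : {poly R}) :
  P \Po (b *: 'X + a%:P) = \poly_(i < size P) ((P^`N(i)).[a] * b ^+ i).
Proof.
rewrite comp_polyE poly_def addrC.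
have := @nderiv_taylor {poly R} P^:P a%:P (b *: 'X) (mulrC _ _).
rewrite size_map_polyC horner_coef size_map_polyC => E.
transitivity (\sum_(i < size P) P^:P`_i * (a%:P + b *: 'X) ^+ i).
  by apply: eq_bigr => i _; rewrite coef_map /= mul_polyC.
rewrite E; apply: eq_bigr => i _.
by rewrite nderivn_map horner_map exprZn /= mul_polyC scalerA.
Qed.

Lemma coef_comp_affine (R : comNzRingType) (a b : R) (P : {poly R}) i :
  (P \Po (b *: 'X + a%:P))`_i = (P^`N(i)).[a] * b ^+ i.
Proof.
rewrite comp_poly_affine coef_poly; case: ltnP => // h.
by rewrite nderivn_poly0 // horner0 mul0r.
Qed.

(** * Content and dominant degree at [p] *)

Lemma dvdz_nderivn (D : int) (Q : {poly int}) d a :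
  (forall i, (d <= i)%N -> (D %| Q`_i)%Z) ->
  forall i, (d <= i)%N -> (D %| (Q^`N(i)).[a])%Z.
Proof.
move=> h i di; rewrite horner_coef; apply: rpred_sum => j _.
by rewrite coef_nderivn dvdz_mulr // rpredMn // h // (leq_trans di) // leq_addr.
Qed.

(** The constant term of the normalized derivative is the coefficient [d] of [Q]; its other terms
    involve only coefficients of larger index. *)
Lemma dvdz_nderivn_lead (D : int) (Q : {poly int}) d a :
  (forall i, (d < i)%N -> (D %| Q`_i)%Z) ->
  (D %| (Q^`N(d)).[a] - Q`_d)%Z.
Proof.
move=> h; rewrite (@horner_coef_wide _ (size Q^`N(d)).+1) // big_ord_recl.
rewrite coef_nderivn addn0 binn mulr1n expr0 mulr1 addrC addKr.
apply: rpred_sum => j _.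
by rewrite coef_nderivn dvdz_mulr // rpredMn // h // -addSnnS leq_addr.
Qed.

(* [p ^ V] is the content of [Q] at [p], and [d] the degree of the reduction of
   [p ^ (-V) Q] modulo [p]. *)
Definition lead_exp (p : nat) (Q : {poly int}) (V d : nat) : Prop :=
  [/\ forall i, (p%:Z ^+ V %| Q`_i)%Z,
      forall i, (d < i)%N -> (p%:Z ^+ V.+1 %| Q`_i)%Z
    & ~~ (p%:Z ^+ V.+1 %| Q`_d)%Z].

Lemma dvdz_exp_le (p : int) (m n : nat) (x : int) :
  (m <= n)%N -> (p ^+ n %| x)%Z -> (p ^+ m %| x)%Z.
Proof. by move=> mn; apply: dvdz_trans; apply: dvdz_exp2l. Qed.

(** [V] is the least exponent for which [p ^ (V + 1)] fails to divide some coefficient, and [d] the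
    largest index where it fails. *)
Lemma lead_exp_exists (p : nat) (Q : {poly int}) (i k : nat) :
  ~~ (p%:Z ^+ k %| Q`_i)%Z -> exists V d, lead_exp p Q V d.
Proof.
move=> nik.
pose ndvd k i := ~~ (p%:Z ^+ k %| Q`_i)%Z.
have ltsz j m : ndvd m j -> (j <= size Q)%N.
  by rewrite /ndvd leqNgt; apply: contra => /ltnW h; rewrite nth_default ?dvdz0.
pose bad k := [exists i : 'I_(size Q).+1, ndvd k.+1 i].
have [|V badV minV] := @ex_minnP bad.
  exists k; apply/existsP; exists (Ordinal (ltsz i k nik : (i < _.+1)%N)).
  exact: (contra (@dvdz_exp_le p k k.+1 Q`_i (leqnSn k))).
have [||d badd maxd] := @ex_maxnP (ndvd V.+1) (size Q).
- by case/existsP: badV => j hj; exists j.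
- by move=> j; apply: ltsz.
exists V, d; split=> // [j|j dj]; last first.
  by apply/negPn/negP => /maxd; rewrite leqNgt dj.
case: V minV {badV d badd maxd} => [|V] minV; first by rewrite expr0 dvd1z.
apply/negPn/negP => nj; suff /minV : bad V by rewrite ltnn.
by apply/existsP; exists (Ordinal (ltsz j _ nj : (j < _.+1)%N)).
Qed.

Section Restriction.

Variables (p : nat) (p_prime : prime p) (Q : {poly int}) (V d : nat).
Hypothesis leadQ : lead_exp p Q V d.

Let p_gt1 : (1 < p)%N. Proof. exact: prime_gt1. Qed.
Let p_neq0 k : p%:Z ^+ k != 0. Proof. by rewrite expf_neq0 // -lt0n ltnW. Qed.

Lemma dvdz_coef_nderivn i a : (p%:Z ^+ V %| (Q^`N(i)).[a])%Z.
Proof. by case: leadQ => h _ _; apply: (dvdz_nderivn (d := 0)). Qed.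

Lemma ndvdz_nderivn_lead a : ~~ (p%:Z ^+ V.+1 %| (Q^`N(d)).[a])%Z.
Proof.
case: leadQ => _ hgt; apply: contra => h.
by rewrite -(subKr (Q^`N(d)).[a] Q`_d) rpredB // dvdz_nderivn_lead.
Qed.

(* The multiplicity of the residue class of [a] as a root of the reduction of
   [p ^ (-V) Q] is the least [e] below, and passing to the class can only
   lower the index of the dominant coefficient to at most [e]. *)
Lemma lead_exp_restrict a :
  (p%:Z ^+ V.+1 %| Q.[a])%Z ->
  exists V' d',
    [/\ lead_exp p (p%:Z *: (Q \Po (p%:Z *: 'X + a%:P))) V' d',
        (V.+2 <= V')%N, (d' <= d)%N &
        d' = d -> forall b, (p%:Z ^+ V.+1 %| Q.[b])%Z -> (p%:Z %| b - a)%Z].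
Proof.
move=> roota; set Qa := _ *: _.
have coefQa i : Qa`_i = p%:Z ^+ i.+1 * (Q^`N(i)).[a].
  by rewrite coefZ coef_comp_affine exprS -mulrA [_ * p%:Z ^+ i]mulrC.
have [|e ne mine] := @ex_minnP (fun i => ~~ (p%:Z ^+ V.+1 %| (Q^`N(i)).[a])%Z).
  by exists d; apply: ndvdz_nderivn_lead.
have ed : (e <= d)%N by apply: mine; apply: ndvdz_nderivn_lead.
have nQae : ~~ (p%:Z ^+ (e.+1 + V.+1) %| Qa`_e)%Z.
  by rewrite coefQa exprD dvdz_mul2l.
have [V' [d' leadQa]] := lead_exp_exists nQae.
exists V', d'; move: (leadQa) => [hall hgt hd'].
(* Above index [e] the coefficients of [Qa] carry at least [p ^ (V + e + 2)], while coefficient [e]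
   forces [V' <= V + e + 1]. *)
have d'e : (d' <= e)%N.
  rewrite leqNgt; apply: contra hd' => ed'.
  have V'le : (V' < e.+1 + V.+1)%N.
    by rewrite ltnNge; apply: contra nQae => h; apply: dvdz_exp_le h (hall e).
  apply: (@dvdz_exp_le _ _ (d'.+1 + V)); first lia.
  by rewrite coefQa exprD dvdz_mul // dvdz_coef_nderivn.
split=> //.
(* [p ^ (V + 2)] divides the constant coefficient because [a] is a root, and the coefficient of
   index [i >= 1] through its factor [p ^ (i + 1)]. *)
- rewrite leqNgt; apply: contra hd' => V'lt.
  apply: (dvdz_exp_le V'lt); rewrite coefQa; case: d' {hgt d'e leadQa} => [|i].
    by rewrite expr1 exprS dvdz_mul // nderivn0.
  apply: (@dvdz_exp_le _ _ (i.+2 + V)); first lia.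
  by rewrite exprD dvdz_mul // dvdz_coef_nderivn.
- exact: leq_trans ed.
(* Modulo [p ^ (V + 1)] only the Taylor term of index [d] survives: lower ones vanish by minimality
   of [e], higher ones by the choice of [d]. The sum is taken wide enough to contain index [d]. *)
move=> d'd b rootb; have {ed d'e d'd} ed : e = d by lia.
rewrite -(subrKC a b) (nderiv_taylor_wide (mulrC _ _)
  (leq_trans (leqnSn _) (leq_addl d.+1 (size Q).+1))) in rootb.
rewrite (bigD1 (Ordinal (leq_addr (size Q).+1 d.+1 : d < _)%N)) //= in rootb.
rewrite rpredDr in rootb; last first.
  apply: rpred_sum => i; rewrite -val_eqE /= => id.
  apply: dvdz_mulr; have [di|ltid|/eqP] := ltngtP d i; last by rewrite eq_sym (negPf id).
    by case: leadQ => _ h _; apply: (@dvdz_nderivn _ _ d.+1).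
  by apply/negPn/negP => /mine; rewrite ed leqNgt ltid.
apply/negPn/negP => nba; case/negP: (ndvdz_nderivn_lead a).
rewrite Gauss_dvdzl // in rootb.
by rewrite coprimezE !abszX coprimeXl // coprimeXr // prime_coprime.
Qed.

End Restriction.

(** * Taylor expansion and sums over one digit *)

Lemma nderivnS_deriv (R : nzRingType) (P : {poly R}) i :
  P^`N(i.+1) *+ i.+1 = (P^`())^`N(i).
Proof.
apply/polyP => k; rewrite coefMn !coef_nderivn coef_deriv -!mulrnA.
by rewrite addSn [('C(_, i.+1) * _)%N]mulnC -mul_bin_diag.
Qed.

Lemma coef_nderivn_lead (R : comNzRingType) (Q : {poly R}) n a :
  (size Q <= n.+1)%N -> (Q^`N(n)).[a] = Q`_n.
Proof.
move=> sQ; have sT : (size Q^`N(n) <= 1)%N.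
  by apply/leq_sizeP => j j0; rewrite coef_nderivn nth_default ?mul0rn // (leq_trans sQ) // -addn1 leq_add2l.
by rewrite (size1_polyC sT) hornerC coef_nderivn addn0 binn.
Qed.

Lemma taylor2 (R : comNzRingType) (P : {poly R}) x h :
  P.[x + h] = P.[x] + P^`().[x] * h
              + \sum_(i < size P) (P^`N(i.+2)).[x] * h ^+ i.+2.
Proof.
rewrite (nderiv_taylor_wide (mulrC _ _) (leqW (leqnSn (size P)))).
by rewrite !big_ord_recl nderivn0 nderivn1 expr0 expr1 mulr1 addrA.
Qed.

Lemma PoszX (m k : nat) : (m ^ k)%N%:Z = m%:Z ^+ k.
Proof. by rewrite -!natz natrX. Qed.

(** Write [x = i + p ^ w (z + p y)]; for fixed [i] and [y] the sum over the digit [z] vanishes. *)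
Lemma sum_shift_eq0 (R : nmodType) (p w M : nat) (F : int -> R) :
  (w < M)%N ->
  (forall x, \sum_(z < p) F (x + p%:Z ^+ w * z%:Z) = 0) ->
  \sum_(x < p ^ M) F x%:Z = 0.
Proof.
move=> wM F0; have -> : (p ^ M = p ^ w * (p * p ^ (M - w.+1)))%N.
  by rewrite -expnS -expnD; congr expn; lia.
rewrite (sum_split _ _ (fun k => F k%:Z)) big1 // => i _.
rewrite (sum_split _ _ (fun k => F (i + p ^ w * k)%N%:Z)) exchange_big big1 // => y _.
rewrite -[RHS](F0 (i%:Z + p%:Z ^+ w * p%:Z * y%:Z)); apply: eq_bigr => z _.
by congr F; rewrite PoszD PoszM PoszD PoszM PoszX; ring.
Qed.

(** * Recursion over residue classes *)

Section ExponentialSum.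

Variables (R : realDomainType) (p : nat) (p_prime : prime p) (K : nat).
Variables (phi : int -> R) (rho : R).
Hypothesis phi_le : forall k, `|phi k| <= rho.
Hypothesis phi_periodic : forall k l, phi (k + p%:Z ^+ K * l) = phi k.
Hypothesis phi_cancel : forall k h, (0 < K)%N -> ~~ (p%:Z %| h)%Z ->
  \sum_(z < p) phi (k + p%:Z ^+ K.-1 * h * z%:Z) = 0.

Let p_gt1 : (1 < p)%N. Proof. exact: prime_gt1. Qed.
Let p_neq0 k : p%:Z ^+ k != 0. Proof. by rewrite expf_neq0 // -lt0n ltnW. Qed.

(** [M] is independent of [K]: restricting to a residue class lowers [M] while [phi] keeps its
    period [p ^ K]. *)
Definition poly_sum (M : nat) (P : {poly int}) : R := \sum_(x < p ^ M) phi P.[x%:Z].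

Lemma poly_sum_trivial M P : `|poly_sum M P| <= rho * (p ^ M)%:R.
Proof.
apply: le_trans (ler_norm_sum _ _ _) _.
apply: le_trans (ler_sum _ (fun i _ => phi_le _)) _.
by rewrite sumr_const card_ord mulr_natr.
Qed.

Lemma poly_sumS M P :
  poly_sum M.+1 P = \sum_(a < p) poly_sum M (P \Po (p%:Z *: 'X + a%:Z%:P)).
Proof.
rewrite /poly_sum expnS (sum_split _ _ (fun k => phi P.[k%:Z])).
apply: eq_bigr => a _; apply: eq_bigr => y _.
by rewrite horner_comp !hornerE PoszD PoszM addrC.
Qed.

Lemma poly_sum_add M P : (K <= M)%N -> poly_sum M.+1 P = poly_sum M P *+ p.
Proof.
move=> KM; rewrite /poly_sum expnSr (sum_split _ _ (fun k => phi P.[k%:Z])).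
rewrite -sumrMnl; apply: eq_bigr => x _.
transitivity (\sum_(y < p) phi P.[x%:Z]); last by rewrite sumr_const card_ord.
apply: eq_bigr => y _.
have pM : p%:Z ^+ M = p%:Z ^+ K * p%:Z ^+ (M - K) by rewrite -exprD subnKC.
rewrite PoszD PoszM (nderiv_taylor_wide (mulrC _ _) (leqnSn _)) big_ord_recl.
rewrite expr0 mulr1 nderivn0 PoszX pM.
set s := \sum_(_ < _) _; have /dvdzP[q ->] : (p%:Z ^+ K %| s)%Z.
  apply: rpred_sum => i _; rewrite lift0 exprS -!mulrA dvdz_mull //.
  by rewrite dvdz_mulr.
by rewrite [q * _]mulrC phi_periodic.
Qed.

Section Shift.

Variables (P : {poly int}) (V w : nat).
Hypothesis dvdQ : forall i, (p%:Z ^+ V %| P^`()`_i)%Z.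
Hypothesis defK : K = (V + w).+1.
Hypothesis w_large : (2 <= w)%N || (size P <= 2)%N.

(** With [j = i + 2] and [p ^ e] the exact power of [p] in [j], the Taylor coefficient loses at most
    [p ^ e] against the content of [P']. Then [w j - e >= w + 1], since [e + 1 <= j <= 2 (j - 1)]
    and [w >= 2]. *)
Lemma dvdz_taylor_tail x z i :
  (p%:Z ^+ K %| (P^`N(i.+2)).[x] * (p%:Z ^+ w * z) ^+ i.+2)%Z.
Proof.
case/orP: w_large => [w2|sP]; last by rewrite nderivn_poly0 ?(leq_trans sP) // horner0 mul0r.
have [u cpu def_i] := pfactor_coprime p_prime (ltn0Sn i.+1).
set e := logn p i.+2 in def_i.
have ltei : (e < i.+2)%N by rewrite /e ltn_logl.
have dT : (p%:Z ^+ V %| p%:Z ^+ e * (P^`N(i.+2)).[x])%Z.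
  rewrite -(@Gauss_dvdzr _ u%:Z); last by rewrite coprimezE abszX coprimeXl.
  have -> : u%:Z * (p%:Z ^+ e * (P^`N(i.+2)).[x]) = (P^`N(i.+2)).[x] *+ i.+2.
    by rewrite def_i -mulr_natl natz PoszM PoszX mulrA.
  by rewrite -hornerMn nderivnS_deriv; apply: (dvdz_nderivn (d := 0)).
rewrite exprMn mulrA dvdz_mulr // -exprM.
have -> : (w * i.+2 = e + w.+1 + (w * i.+2 - (e + w.+1)))%N by nia.
rewrite defK !exprD mulrA dvdz_mulr // -addnS exprD mulrA dvdz_mul //.
by rewrite mulrC.
Qed.

(** Modulo [p ^ K] the shift adds [p ^ (K - 1) q z] with [q] prime to [p], so [phi_cancel]
    applies. *)
Lemma sum_shift_phi x :
  ~~ (p%:Z ^+ V.+1 %| P^`().[x])%Z ->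
  \sum_(z < p) phi P.[x + p%:Z ^+ w * z%:Z] = 0.
Proof.
move=> nQx; have /dvdzP[q defq] : (p%:Z ^+ V %| P^`().[x])%Z.
  by rewrite horner_coef; apply: rpred_sum => i _; rewrite dvdz_mulr.
have npq : ~~ (p%:Z %| q)%Z.
  by apply: contra nQx; rewrite defq exprS => h; apply: dvdz_mul.
rewrite -[RHS](phi_cancel P.[x] _ npq) ?defK //; apply: eq_bigr => z _.
rewrite taylor2; set s := \sum_(_ < _) _; have /dvdzP[t ->] : (p%:Z ^+ K %| s)%Z.
  by apply: rpred_sum => i _; apply: dvdz_taylor_tail.
rewrite [t * _]mulrC phi_periodic defq /= exprD; congr phi; ring.
Qed.

End Shift.

(** [P'] is constant modulo [p ^ (V + 1)] on the class. Shifting [a + p y] by [p ^ (K - V - 1)]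
    means shifting [y] by [p ^ (K - V - 2)], which leaves a digit below [M]. *)
Lemma poly_sum_nonroot M V (P : {poly int}) (a : int) :
  (forall i, (p%:Z ^+ V %| P^`()`_i)%Z) ->
  ~~ (p%:Z ^+ V.+1 %| P^`().[a])%Z ->
  (V + 3 <= K)%N -> (K <= V + M.+1)%N ->
  poly_sum M (P \Po (p%:Z *: 'X + a%:P)) = 0.
Proof.
move=> dvdQ nQa VK KM.
apply: (@sum_shift_eq0 _ p (K - V - 2) M (fun x => phi (P \Po (p%:Z *: 'X + a%:P)).[x])); first lia.
move=> y; have nQx : ~~ (p%:Z ^+ V.+1 %| P^`().[a + p%:Z * y])%Z.
  apply: contra nQa; rewrite (nderiv_taylor_wide (mulrC _ _) (leqnSn _)) big_ord_recl.
  rewrite expr0 mulr1 nderivn0 rpredDr //; apply: rpred_sum => i _.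
  rewrite lift0 [_ ^+ i.+1]exprS exprSr -mulrA; apply: dvdz_mul.
    exact: (dvdz_nderivn (d := 0)).
  by rewrite dvdz_mulr // dvdz_mulr.
rewrite -[RHS](@sum_shift_phi P V (K - V - 1) dvdQ _ _ _ nQx); first last.
- by apply/orP; left; lia.
- lia.
apply: eq_bigr => z _; rewrite horner_comp !hornerE; congr (phi P.[_]).
have -> : (K - V - 1 = (K - V - 2).+1)%N by lia.
by rewrite exprS; ring.
Qed.

(** [P'] is a constant of valuation [V <= v], and the shift by [p ^ (K - V - 1)] has no second-order
    terms. *)
Lemma poly_sum_linear M v (P : {poly int}) :
  (size P <= 2)%N -> ~~ (p%:Z ^+ v.+1 %| P^`()`_0%N)%Z -> (v < K <= M)%N ->
  poly_sum M P = 0.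
Proof.
move=> sP nP vKM; have [V [d [dall dgt nd]]] := lead_exp_exists nP.
have sQ : (size P^`() <= 1)%N by apply: leq_trans (size_poly _ _) _; lia.
have d0 : d = 0%N by case: d nd {dgt} => // d; rewrite nth_default ?dvdz0 // (leq_trans sQ).
have Vv : (V <= v)%N.
  by rewrite leqNgt; apply: contra nP => h; apply: dvdz_exp_le h _.
apply: (@sum_shift_eq0 _ p (K - V - 1) M (fun x => phi P.[x])); first lia.
move=> x; apply: (@sum_shift_phi P V) => //; first lia.
  by rewrite sP orbT.
by rewrite (size1_polyC sQ) hornerC -d0.
Qed.

Lemma deriv_restrict (P : {poly int}) (a : int) :
  (P \Po (p%:Z *: 'X + a%:P))^`() = p%:Z *: (P^`() \Po (p%:Z *: 'X + a%:P)).
Proof. by rewrite deriv_comp derivD derivZ derivX derivC addr0 alg_polyC mulrC mul_polyC. Qed.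

(** The restricted coefficient is [p ^ (n + 1)] times the old one: the price of one recursion
    step. *)
Lemma ndvdz_coef_restrict n v (Q : {poly int}) a :
  (size Q <= n.+1)%N -> ~~ (p%:Z ^+ v.+1 %| Q`_n)%Z ->
  ~~ (p%:Z ^+ (v + n.+1).+1 %| (p%:Z *: (Q \Po (p%:Z *: 'X + a%:P)))`_n)%Z.
Proof.
move=> sQ nQ.
rewrite coefZ coef_comp_affine coef_nderivn_lead // mulrCA -exprS mulrC -addSn addnC exprD.
by rewrite dvdz_mul2l.
Qed.

(** Here [n + 1] bounds the degree of [P], and [m] counts the factors [p] to be gained. The last
    hypothesis is invariant under [(v, m) -> (v + n + 1, m - 1)] and gives [V + 3 <= K] while
    [m >= 1]; [K <= V + M] persists because [V] grows by at least 2 as [M] drops by 1. *)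
Theorem poly_sum_bound n v m M V d (P : {poly int}) :
  (size P <= n.+2)%N -> ~~ (p%:Z ^+ v.+1 %| P^`()`_n)%Z ->
  lead_exp p P^`() V d -> (K <= V + M)%N ->
  (v + n.+1 * m + 3 <= K + n.+1)%N ->
  `|poly_sum M P| * (p ^ m)%:R <= rho * (p ^ M)%:R * (p ^ d)%:R.
Proof.
have rho_ge0 : 0 <= rho by apply: le_trans (phi_le 0).
elim: m v M V d P => [|m IH] v M V d P sP nP leadP KVM hm.
  rewrite mulr1; apply: le_trans (poly_sum_trivial _ _) _.
  by rewrite ler_peMr ?mulr_ge0 // ler1n expn_gt0 ltnW.
have [dall dgt nd] := leadP.
have Vv : (V <= v)%N.
  by rewrite leqNgt; apply: contra nP => h; apply: dvdz_exp_le h _.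
case: M KVM => [|M] KVM; first by nia.
have VK : (V + 3 <= K)%N by nia.
pose Pa a := P \Po (p%:Z *: 'X + a%:P).
pose B := rho * (p ^ M)%:R * (p ^ d)%:R.
have pR_gt0 : 0 < p%:R :> R by rewrite ltr0n ltnW.
(* Either the class gains a further factor [p], which pays for summing over [p] classes, or it is
   the only class that contributes. *)
have branch (a : 'I_p) :
  `|poly_sum M (Pa a%:Z)| * (p ^ m)%:R * p%:R <= B \/
  `|poly_sum M (Pa a%:Z)| * (p ^ m)%:R <= B /\
    forall b : 'I_p, b != a -> poly_sum M (Pa b%:Z) = 0.
  have [roota|nroota] := boolP (p%:Z ^+ V.+1 %| P^`().[a%:Z])%Z; last first.
    left; rewrite (@poly_sum_nonroot M V) //.
    by rewrite normr0 !mul0r !mulr_ge0.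
  have [V' [d' [leadPa VV' d'd only]]] := lead_exp_restrict p_prime leadP roota.
  have {IH}IHa : `|poly_sum M (Pa a%:Z)| * (p ^ m)%:R <= rho * (p ^ M)%:R * (p ^ d')%:R.
    apply: (IH (v + n.+1)%N M V' d').
    - apply: leq_trans sP; rewrite /Pa comp_poly_affine; exact: size_poly.
    - rewrite deriv_restrict; apply: ndvdz_coef_restrict => //.
      by apply: leq_trans (size_poly _ _) _; lia.
    - by rewrite deriv_restrict.
    - by lia.
    - by nia.
  have [dd'|ltd'] := eqVneq d' d.
    right; split; first by rewrite /B -dd'.
    move=> b ba; rewrite (@poly_sum_nonroot M V) //.
    apply: contra ba => /(only dd'); rewrite -eqz_mod_dvd !modz_nat eqz_nat.
    by rewrite !modn_small.
  left; apply: le_trans (_ : rho * (p ^ M)%:R * (p ^ d')%:R * p%:R <= _).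
    by rewrite ler_pM2r.
  rewrite -mulrA -natrM -expnSr ler_wpM2l ?mulr_ge0 // ler_nat leq_exp2l //.
  by rewrite ltn_neqAle ltd'.
rewrite poly_sumS -/Pa [(p ^ M.+1)%N]expnS [(p ^ m.+1)%N]expnSr !natrM.
rewrite [_ * (p%:R * _)]mulrCA -!mulrA [rho * _]mulrA -/B [X in _ <= X]mulrC.
rewrite mulrA.
have [a nba|allb] := pickP (fun a : 'I_p =>
    ~~ (`|poly_sum M (Pa a%:Z)| * (p ^ m)%:R * p%:R <= B)).
  have [h|[ha only]] := branch a; first by rewrite h in nba.
  rewrite (bigD1 a) //= big1 // addr0; first by rewrite ler_pM2r.
rewrite -mulrA; apply: le_trans (ler_wpM2r _ (ler_norm_sum _ _ _)) _.
  by rewrite mulr_ge0.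
apply: le_trans (_ : \sum_(a < p) B <= _); last by rewrite sumr_const card_ord mulr_natr.
by rewrite mulr_suml; apply: ler_sum => a _; have := allb a; rewrite -mulrA => /negbFE.
Qed.

End ExponentialSum.
(** * Transfer to Stdlib integers and reals *)

Import ssrZ Rstruct.

Lemma Rsum_listE (F : nat -> R) k :
  Rsum_list (List.map F (List.seq 0 k)) = \sum_(i < k) F i.
Proof.
elim: k => [|k IH]; first by rewrite big_ord0.
rewrite big_ord_recr -IH List.seq_S List.map_app /=.
elim: (List.map F _) => [|x s IHs] /=; first by rewrite Rplus_0_r add0r.
by rewrite IHs -addrA.
Qed.

Lemma Z_of_intD (x y : int) : Z_of_int (x + y) = Z.add (Z_of_int x) (Z_of_int y).
Proof. exact: rmorphD. Qed.

Lemma Z_of_intM (x y : int) : Z_of_int (x * y) = Z.mul (Z_of_int x) (Z_of_int y).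
Proof. exact: rmorphM. Qed.

Lemma Z_of_intX (x : int) k : Z_of_int (x ^+ k) = Z.pow (Z_of_int x) (Z.of_nat k).
Proof.
elim: k => [|k IH]; first by [].
rewrite exprS Z_of_intM IH Nat2Z.inj_succ Z.pow_succ_r //; exact: Nat2Z.is_nonneg.
Qed.

Lemma dvdz_Z_of_int (d x : int) : reflect (Z.divide (Z_of_int d) (Z_of_int x)) (d %| x)%Z.
Proof.
apply: (iffP dvdzP) => [[q ->]|[q]]; first by exists (Z_of_int q); rewrite Z_of_intM.
move=> defx; exists (int_of_Z q); apply: (can_inj Z_of_intK).
by rewrite Z_of_intM int_of_ZK.
Qed.

Lemma prime_to_nat (p : Z) : Znumtheory.prime p -> prime (Z.to_nat p).
Proof.
move=> pp; have p2 := Znumtheory.prime_ge_2 p pp.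
apply/primeP; split; first by lia.
move=> d /dvdnP[q defp]; have : Z.divide (Z.of_nat d) p by exists (Z.of_nat q); lia.
by move=> /(Znumtheory.prime_divisors p pp) [|[|[]]] h; apply/orP; lia.
Qed.

Section Transfer.

Variables (p : Z) (p_prime : Znumtheory.prime p) (K : nat) (phi : Z -> R) (rho : R).
Hypothesis phase_phi : phase p K rho phi.
Variables (c : nat -> Z) (n : nat) (A B : Z).

Let q := Z.to_nat p.
Let psi (k : int) := phi (Z_of_int k).
Let P : {poly int} :=
  (\poly_(i < n.+1) int_of_Z (c i)) \Po (int_of_Z B *: 'X + (int_of_Z A)%:P).

Let q_prime : prime q. Proof. exact: prime_to_nat. Qed.

Let Z_of_q : Z_of_int q%:Z = p.
Proof. by rewrite /= /q Z2Nat.id //; have := Znumtheory.prime_ge_2 p p_prime; lia. Qed.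

Let pN_q k : Z_of_int (q%:Z ^+ k) = pN p k.
Proof. by rewrite Z_of_intX Z_of_q. Qed.

Let to_nat_pN k : Z.to_nat (pN p k) = (q ^ k)%N.
Proof. by rewrite -pN_q -PoszX /= Nat2Z.id. Qed.

Let psi_le k : `|psi k| <= rho.
Proof. by have [h _] := phase_phi; apply/RleP; rewrite -RabsE; apply: h. Qed.

Let psi_periodic k l : psi (k + q%:Z ^+ K * l) = psi k.
Proof. by have [_ [h _]] := phase_phi; rewrite /psi Z_of_intD Z_of_intM pN_q h. Qed.

Let psi_cancel k h : (0 < K)%N -> ~~ (q%:Z %| h)%Z ->
  \sum_(z < q) psi (k + q%:Z ^+ K.-1 * h * z%:Z) = 0.
Proof.
move=> /ssrnat.ltP K0 /dvdz_Z_of_int nqh; rewrite Z_of_q in nqh.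
have [_ [_ hc]] := phase_phi; have := hc (Z_of_int k) _ K0 nqh.
by rewrite Rsum_listE; apply: etrans; apply: eq_bigr => z _; rewrite /psi Z_of_intD !Z_of_intM pN_q Nat.sub_1_r.
Qed.

Let value_P x : Z_of_int P.[x] = affine_value c n A B (Z_of_int x).
Proof.
rewrite horner_comp !hornerE horner_poly rmorph_sum /affine_value.
set y := _ + _; have -> : Z.add A (Z.mul B (Z_of_int x)) = Z_of_int y.
  by rewrite /y Z_of_intD Z_of_intM !int_of_ZK Z.add_comm.
have -> : \sum_(i < n.+1) Z_of_int (int_of_Z (c i) * y ^+ i)
       = \sum_(i < n.+1) Z.mul (c i) (Z.pow (Z_of_int y) (Z.of_nat i)).
  by apply: eq_bigr => i _; rewrite Z_of_intM Z_of_intX int_of_ZK.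
have -> : List.seq 0 n.+1 = iota 0 n.+1.
  by elim: (n.+1) (0%N) => //= k IH i; rewrite IH.
by rewrite -(big_mkord xpredT (fun i => Z.mul (c i) (Z.pow (Z_of_int y) (Z.of_nat i)))) unlock /index_iota subn0.
Qed.

Let phase_sumE M : phase_sum p phi (affine_value c n A B) M = poly_sum q psi M P.
Proof.
rewrite /phase_sum to_nat_pN Rsum_listE; apply: eq_bigr => x _.
by rewrite /psi value_P.
Qed.

Let size_P : (size P <= n.+1)%N.
Proof. by rewrite /P comp_poly_affine (leq_trans (size_poly _ _)) // size_poly. Qed.

Let lead_P : Z_of_int P`_n = Z.mul (c n) (Z.pow B (Z.of_nat n)).
Proof.
rewrite coef_comp_affine coef_nderivn_lead ?size_poly // coef_poly ltnSn.
by rewrite Z_of_intM Z_of_intX !int_of_ZK.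
Qed.

Let deriv_lead_P v m : n = m.+1 ->
  ~ Z.divide (pN p v.+1) (Z.mul (Z.of_nat n) (Z.mul (c n) (Z.pow B (Z.of_nat n)))) ->
  ~~ (q%:Z ^+ v.+1 %| P^`()`_m)%Z.
Proof.
move=> nm h; apply/dvdz_Z_of_int; rewrite pN_q coef_deriv -nm -mulr_natl natz Z_of_intM.
by rewrite lead_P.
Qed.

Let INR_expn k : (q ^ k)%N%:R = pow (IZR p) k :> R.
Proof.
rewrite RpowE natrX -INRE -[in RHS]Z_of_q INR_IZR_INZ //.
Qed.

Lemma phase_sum_trivial M :
  Rle (Rabs (phase_sum p phi (affine_value c n A B) M)) (Rmult rho (pow (IZR p) M)).
Proof.
apply/RleP; rewrite phase_sumE RabsE RmultE -INR_expn.
exact: poly_sum_trivial psi_le _ _.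
Qed.

Lemma phase_sumS M : le K M ->
  phase_sum p phi (affine_value c n A B) (S M)
  = Rmult (IZR p) (phase_sum p phi (affine_value c n A B) M).
Proof.
move=> /ssrnat.leP KM; rewrite !phase_sumE (poly_sum_add psi_periodic _ KM) -mulr_natl.
by have -> : q%:R = IZR p :> R by rewrite -[RHS]pow_1 -INR_expn expn1.
Qed.

Lemma phase_sum_linear v M : n = 1%N ->
  ~ Z.divide (pN p (S v)) (Z.mul (c 1%N) B) -> lt v K -> le K M ->
  phase_sum p phi (affine_value c n A B) M = IZR Z0.
Proof.
move=> n1 nd /ssrnat.ltP vK /ssrnat.leP KM; rewrite phase_sumE.
apply: (@poly_sum_linear _ q q_prime K psi psi_periodic psi_cancel M v).
- by rewrite -n1.
- by apply: deriv_lead_P => //; rewrite n1 Z.pow_1_r Z.mul_1_l.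
- by rewrite vK.
Qed.

(** The dominant degree of the derivative is at most [n - 1], whence the factor [p ^ (n - 1)]. *)
Lemma phase_sum_bound v m M : lt 0 n -> le K M ->
  ~ Z.divide (pN p (S v)) (Z.mul (Z.of_nat n) (Z.mul (c n) (Z.pow B (Z.of_nat n)))) ->
  le (Nat.add (Nat.add v (Nat.mul n m)) 3) (Nat.add K n) ->
  Rle (Rmult (Rabs (phase_sum p phi (affine_value c n A B) M)) (pow (IZR p) m))
      (Rmult (Rmult rho (pow (IZR p) M)) (pow (IZR p) (Nat.pred n))).
Proof.
move=> n0 /ssrnat.leP KM nd hm; have defn : n = n.-1.+1 by lia.
have ndP := deriv_lead_P defn nd.
have [V [d leadP]] := lead_exp_exists ndP.
have dn : (d <= n.-1)%N.
  have [_ _] := leadP; rewrite leqNgt; apply: contra => nd'.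
  rewrite nth_default ?dvdz0 // (leq_trans (size_poly _ _)) //.
  by have := size_P; lia.
apply/RleP; rewrite !RmultE phase_sumE RabsE -!INR_expn.
apply: le_trans (_ : rho * (q ^ M)%:R * (q ^ d)%:R <= _); last first.
  rewrite ler_wpM2l ?mulr_ge0 ?(le_trans _ (psi_le 0)) // ler_nat.
  by rewrite leq_exp2l // prime_gt1.
apply: (poly_sum_bound q_prime psi_le psi_periodic psi_cancel _ ndP leadP).
- by rewrite -defn.
- by lia.
- by rewrite -defn; lia.
Qed.

End Transfer.

End PolynomialSums.

(** * Additive characters of Z / p^K *)

(** The real part of [u - i v] times the character: one real phase for every direction in the
    plane. *)
Definition wave (p : Z) (K : nat) (u v : R) (k : Z) : R :=
  (u * cos (2 * PI * IZR k / IZR (pN p K)) + v * sin (2 * PI * IZR k / IZR (pN p K)))%R.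

Lemma pN_S (p : Z) (N : nat) : pN p (S N) = p * pN p N.
Proof. unfold pN. rewrite Nat2Z.inj_succ, Z.pow_succ_r; lia. Qed.

Lemma pN_pos (p : Z) (N : nat) : prime p -> 0 < pN p N.
Proof. intros Hp. apply prime_ge_2 in Hp. apply Z.pow_pos_nonneg; lia. Qed.

Lemma IZR_pN (p : Z) (N : nat) : IZR (pN p N) = (IZR p ^ N)%R.
Proof. unfold pN. now rewrite <- pow_IZR. Qed.

Lemma IZR_prime_gt_1 (p : Z) : prime p -> (1 < IZR p)%R.
Proof. intros Hp. apply prime_ge_2 in Hp. apply (IZR_lt 1). lia. Qed.

Lemma cos_sin_Zperiod (x : R) (k : Z) :
  cos (x + 2 * IZR k * PI) = cos x /\ sin (x + 2 * IZR k * PI) = sin x.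
Proof.
  destruct (Z_le_gt_dec 0 k) as [Hk | Hk].
  - rewrite <- (Z2Nat.id k Hk), <- INR_IZR_INZ.
    now rewrite cos_period, sin_period.
  - set (y := (x + 2 * IZR k * PI)%R).
    assert (Hx : x = (y + 2 * INR (Z.to_nat (- k)) * PI)%R).
    { unfold y. rewrite INR_IZR_INZ, Z2Nat.id, opp_IZR by lia. ring. }
    now rewrite Hx, cos_period, sin_period.
Qed.

Lemma wave_periodic (p : Z) (K : nat) (u v : R) (k l : Z) :
  prime p -> wave p K u v (k + pN p K * l) = wave p K u v k.
Proof.
  intros Hp. unfold wave.
  assert (HpN : IZR (pN p K) <> 0%R)
    by (apply not_0_IZR; pose proof (pN_pos p K Hp); lia).
  replace (2 * PI * IZR (k + pN p K * l) / IZR (pN p K))%R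
    with (2 * PI * IZR k / IZR (pN p K) + 2 * IZR l * PI)%R
    by (rewrite plus_IZR, mult_IZR; field; exact HpN).
  now destruct (cos_sin_Zperiod (2 * PI * IZR k / IZR (pN p K)) l) as [-> ->].
Qed.

Lemma wave_eqm (p : Z) (K : nat) (u v : R) (k l : Z) :
  prime p -> Zdiv.eqm (pN p K) k l -> wave p K u v k = wave p K u v l.
Proof.
  intros Hp Hkl. unfold Zdiv.eqm in Hkl.
  rewrite (Z_div_mod_eq_full k (pN p K)), (Z_div_mod_eq_full l (pN p K)), <- Hkl.
  now rewrite 2!(Z.add_comm (pN p K * _)), 2!wave_periodic.
Qed.

(** Cauchy-Schwarz; the defect is the square of [u sin x - v cos x]. *)
Lemma wave_le (p : Z) (K : nat) (u v : R) (k : Z) :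
  (Rabs (wave p K u v k) <= sqrt (u ^ 2 + v ^ 2))%R.
Proof.
  unfold wave. set (x := (2 * PI * IZR k / IZR (pN p K))%R).
  rewrite <- sqrt_Rsqr_abs. apply sqrt_le_1_alt.
  pose proof (sin2_cos2 x) as H. unfold Rsqr in *.
  assert (E : (u ^ 2 + v ^ 2 = (u ^ 2 + v ^ 2) * (sin x * sin x + cos x * cos x))%R)
    by (rewrite H; ring).
  rewrite E.
  pose proof (Rle_0_sqr (u * sin x - v * cos x)%R) as H2. unfold Rsqr in H2. nra.
Qed.

Lemma Rsum_list_app (l l' : list R) :
  Rsum_list (l ++ l') = (Rsum_list l + Rsum_list l')%R.
Proof. induction l as [|x l IH]; simpl; [ring | rewrite IH; ring]. Qed.

Lemma Rsum_list_lin {T} (a b : R) (f g : T -> R) (l : list T) :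
  Rsum_list (map (fun z => (a * f z + b * g z)%R) l)
  = (a * Rsum_list (map f l) + b * Rsum_list (map g l))%R.
Proof. induction l as [|x l IH]; simpl; [ring | rewrite IH; ring]. Qed.

(** Telescoping, by [2 sin (beta / 2) cos y = sin (y + beta / 2) - sin (y - beta / 2)]. *)
Lemma sum_cos_arith (theta beta : R) (n : nat) :
  (2 * sin (beta / 2) *
   Rsum_list (map (fun z => cos (theta + beta * INR z)) (seq 0 n))
   = sin (theta - beta / 2 + beta * INR n) - sin (theta - beta / 2))%R.
Proof.
  induction n as [|n IH].
  - cbn [seq map Rsum_list fold_right]. change (INR 0) with 0%R. rewrite (Rmult_0_r beta), Rplus_0_r. ring.
  - rewrite seq_S, map_app, Rsum_list_app, Rmult_plus_distr_l, IH.
    simpl (0 + n)%nat. cbn [map Rsum_list fold_right]. rewrite S_INR.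
    set (y := (theta + beta * INR n)%R).
    replace (theta - beta / 2 + beta * (INR n + 1))%R with (y + beta / 2)%R by (unfold y; lra).
    replace (theta - beta / 2 + beta * INR n)%R with (y - beta / 2)%R by (unfold y; lra).
    rewrite sin_plus, sin_minus. ring.
Qed.

(** The telescoped ends differ by [2 h PI], and [sin (PI h / p)] is nonzero since [p] does not
    divide [h]. *)
Lemma sum_cos_roots_of_unity (p h : Z) (theta : R) :
  prime p -> ~ (p | h) ->
  Rsum_list (map (fun z => cos (theta + 2 * PI * IZR h / IZR p * INR z))
                 (seq 0 (Z.to_nat p))) = 0%R.
Proof.
  intros Hp Hh. pose proof (prime_ge_2 p Hp) as Hp2.
  assert (Hp0 : IZR p <> 0%R) by (apply not_0_IZR; lia).
  pose proof (sum_cos_arith theta (2 * PI * IZR h / IZR p) (Z.to_nat p)) as H.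
  rewrite (INR_IZR_INZ (Z.to_nat p)), Z2Nat.id in H by lia.
  replace (2 * PI * IZR h / IZR p * IZR p)%R with (2 * IZR h * PI)%R in H
    by (field; exact Hp0).
  rewrite (proj2 (cos_sin_Zperiod _ h)), Rminus_diag in H.
  apply Rmult_integral in H. destruct H as [H | H]; [exfalso | exact H].
  apply Rmult_integral in H. destruct H as [H | H]; [lra |].
  apply sin_eq_0_0 in H. destruct H as [k Hk]. apply Hh. exists k.
  apply eq_IZR. rewrite mult_IZR. pose proof PI_RGT_0.
  apply (Rmult_eq_reg_l (PI / IZR p)).
  - transitivity (2 * PI * IZR h / IZR p / 2)%R; [field; exact Hp0 |].
    rewrite Hk. field. exact Hp0.
  - apply Rmult_integral_contrapositive_currified; [lra | now apply Rinv_neq_0_compat].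
Qed.

Lemma phase_wave (p : Z) (K : nat) (u v : R) :
  prime p -> phase p K (sqrt (u ^ 2 + v ^ 2)) (wave p K u v).
Proof.
  intros Hp. split; [apply wave_le | split].
  - intros k l. now apply wave_periodic.
  - intros k h HK Hh. destruct K as [|K]; [lia |].
    replace (S K - 1)%nat with K by lia.
    set (theta := (2 * PI * IZR k / IZR (pN p (S K)))%R).
    assert (HpN : IZR (pN p K) <> 0%R)
      by (apply not_0_IZR; pose proof (pN_pos p K Hp); lia).
    assert (Hp0 : IZR p <> 0%R)
      by (apply not_0_IZR; pose proof (prime_ge_2 p Hp); lia).
    (* The sine is a cosine shifted by [PI / 2], so one vanishing sum serves both parts. *)
    rewrite (map_ext _ (fun z =>
      (u * cos (theta + 2 * PI * IZR h / IZR p * INR z)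
       + v * cos (theta - PI / 2 + 2 * PI * IZR h / IZR p * INR z))%R)).
    + rewrite Rsum_list_lin, 2!sum_cos_roots_of_unity by assumption. ring.
    + intros z. unfold wave.
      replace (2 * PI * IZR (k + pN p K * h * Z.of_nat z) / IZR (pN p (S K)))%R
        with (theta + 2 * PI * IZR h / IZR p * INR z)%R.
      * set (y := (2 * PI * IZR h / IZR p * INR z)%R).
        replace (theta - PI / 2 + y)%R with (- (PI / 2 - (theta + y)))%R by lra.
        now rewrite cos_neg, cos_shift.
      * unfold theta. rewrite INR_IZR_INZ, pN_S, plus_IZR, !mult_IZR. field. now split.
Qed.

(** * The integral as a complete exponential sum *)

Lemma eqm_pow (M x y : Z) (k : nat) :
  Zdiv.eqm M x y -> Zdiv.eqm M (x ^ Z.of_nat k) (y ^ Z.of_nat k).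
Proof.
  intros H. induction k as [|k IH]; [reflexivity |].
  rewrite Nat2Z.inj_succ, 2!Z.pow_succ_r by lia. now apply Zmult_eqm.
Qed.

Lemma rpow_spec (p : Z) (x : raw) (k N : nat) :
  fst (rpow p x k) = Z.of_nat k * fst x /\
  Zdiv.eqm (pN p N) (snd (rpow p x k) N) (snd x N ^ Z.of_nat k).
Proof.
  induction k as [|k [IH1 IH2]].
  - split; [reflexivity | apply Zmod_eqm].
  - change (rpow p x (S k)) with (rmul p x (rpow p x k)). split.
    + cbn [rmul fst]. rewrite IH1. lia.
    + cbn [rmul snd]. rewrite Nat2Z.inj_succ, Z.pow_succ_r by lia.
      eapply eqm_trans; [apply Zmod_eqm |].
      apply Zmult_eqm; [reflexivity | exact IH2].
Qed.

(** The exponent that [reval] produces; the base value 0 is the exponent of [rzero]. *)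
Definition reval_exp (v : nat -> Z) (m : Z) (l : list nat) : Z :=
  fold_right (fun i acc => Z.min (v i + Z.of_nat i * m) acc) 0 l.

Lemma reval_exp_le_0 (v : nat -> Z) (m : Z) (l : list nat) : reval_exp v m l <= 0.
Proof. induction l; cbn [reval_exp fold_right] in *; [lia |]. fold (reval_exp v m l) in *. lia. Qed.

Lemma reval_exp_le (v : nat -> Z) (m : Z) (l : list nat) (i : nat) :
  In i l -> reval_exp v m l <= v i + Z.of_nat i * m.
Proof.
  induction l as [|k l IH]; [easy |].
  cbn [reval_exp fold_right]. fold (reval_exp v m l).
  intros [<- | H]; [lia | specialize (IH H); lia].
Qed.

(** The claim covers every [e <= e0] because the common exponent drops as terms are added. *)
Lemma reval_list_spec (p : Z) (a : nat -> raw) (x : raw) (N : nat) (l : list nat) :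
  let y := fold_right (fun i acc => radd p (rmul p (a i) (rpow p x i)) acc) rzero l in
  let e0 := reval_exp (fun i => fst (a i)) (fst x) l in
  fst y = e0 /\
  forall e, e <= e0 ->
    Zdiv.eqm (pN p N) (p ^ (e0 - e) * snd y N)
      (fold_right (fun i acc =>
         p ^ (fst (a i) + Z.of_nat i * fst x - e) * snd (a i) N * snd x N ^ Z.of_nat i
         + acc) 0 l).
Proof.
  induction l as [|i l [IH1 IH2]]; cbn zeta in *.
  - split; [reflexivity |]. intros e _. cbn. now rewrite Z.mul_0_r.
  - cbn [fold_right reval_exp].
    fold (reval_exp (fun i => fst (a i)) (fst x) l).
    set (e1 := reval_exp (fun i => fst (a i)) (fst x) l) in *.
    set (y := fold_right _ rzero l) in *.
    destruct (rpow_spec p x i N) as [Hp1 Hp2].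
    cbn [radd rmul fst snd]. rewrite Hp1, IH1.
    set (w := fst (a i) + Z.of_nat i * fst x).
    split; [reflexivity |]. intros e He.
    eapply eqm_trans.
    { apply Zmult_eqm; [reflexivity | apply Zmod_eqm]. }
    rewrite Z.mul_add_distr_l, 2!Z.mul_assoc, <- 2!Z.pow_add_r by lia.
    replace (Z.min w e1 - e + (w - Z.min w e1)) with (w - e) by lia.
    replace (Z.min w e1 - e + (e1 - Z.min w e1)) with (e1 - e) by lia.
    apply Zplus_eqm; [| apply IH2; lia].
    rewrite <- Z.mul_assoc. apply Zmult_eqm; [reflexivity |].
    eapply eqm_trans; [apply Zmod_eqm |].
    apply Zmult_eqm; [reflexivity | exact Hp2].
Qed.

Lemma fold_right_eqm (M : Z) (f g : nat -> Z) (l : list nat) :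
  (forall i, Zdiv.eqm M (f i) (g i)) ->
  Zdiv.eqm M (fold_right (fun i acc => f i + acc) 0 l)
    (fold_right (fun i acc => g i + acc) 0 l).
Proof.
  intros H. induction l as [|i l IH]; cbn; [reflexivity |].
  apply Zplus_eqm; [apply H | exact IH].
Qed.

(** * Clearing denominators on the ball *)

Section Angle.

Variables (p : Z) (Hp : prime p) (n : nat) (x0 : Qp p) (a : nat -> Qp p) (r : Z).

(** The exponent of every raw point of the ball: [x0 + p ^ (-r) j] is [p ^ arg_exp] times
    [shift + dilation * j] modulo [p ^ level]. *)
Definition arg_exp : Z := Z.min (qv x0) (- r).

Definition val_exp : Z :=
  reval_exp (fun i => qv (a i)) arg_exp (seq 0 (S n)).

(* [val_exp <= 0], so nothing is truncated: [p ^ (- val_exp) f(x)] is a p-adic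
   integer at every point [x] of the ball. *)
Definition level : nat := Z.to_nat (- val_exp).

(** Coefficients modulo [p ^ level] of [p ^ (- val_exp) f(p ^ arg_exp y)] as a polynomial in [y]. *)
Definition coef (i : nat) : Z :=
  p ^ (qv (a i) + Z.of_nat i * arg_exp - val_exp) * qu (a i) level.

Definition shift : Z := p ^ (qv x0 - arg_exp) * qu x0 level.

Definition dilation : Z := p ^ (- r - arg_exp).

Let point (j : nat) : raw := radd p (toraw x0) (rnat p (- r) j).

Let value (j : nat) : raw := reval p (fun i => toraw (a i)) n (point j).

Lemma reval_spec (j : nat) :
  fst (value j) = val_exp /\
  Zdiv.eqm (pN p level) (snd (value j) level)
    (affine_value coef n shift dilation (Z.of_nat j)).
Proof.
  destruct (reval_list_spec p (fun i => toraw (a i)) (point j) level (seq 0 (S n)))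
    as [H1 H2].
  fold (reval p (fun i => toraw (a i)) n (point j)) in H1, H2.
  fold (value j) in H1, H2.
  change (reval_exp (fun i => fst (toraw (a i))) (fst (point j)) (seq 0 (S n)))
    with val_exp in H1, H2.
  split; [exact H1 |].
  specialize (H2 val_exp (Z.le_refl _)).
  rewrite Z.sub_diag, Z.pow_0_r, Z.mul_1_l in H2.
  eapply eqm_trans; [exact H2 |].
  unfold affine_value. apply fold_right_eqm. intros i.
  apply Zmult_eqm; [reflexivity |]. apply eqm_pow.
  eapply eqm_trans; [apply Zmod_eqm |].
  apply Zplus_eqm; [reflexivity |].
  apply Zmult_eqm; [reflexivity | apply Zmod_eqm].
Qed.

Lemma wave_value (u v : R) (j : nat) :
  (u * cos (chi_angle p (value j)) + v * sin (chi_angle p (value j)))%R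
  = wave p level u v (affine_value coef n shift dilation (Z.of_nat j)).
Proof.
  destruct (reval_spec j) as [H1 H2].
  rewrite <- (wave_eqm p level u v _ _ Hp H2).
  unfold chi_angle. rewrite H1.
  assert (Hv : val_exp <= 0) by apply reval_exp_le_0.
  destruct (Z.ltb_spec val_exp 0) as [Hlt | Hge].
  - unfold wave, pN, level. now rewrite Z2Nat.id by lia.
  (* At level 0 the modulus is 1, so periodicity reduces the wave to angle 0, the value of
     [chi_angle]. *)
  - assert (Hl : level = 0%nat) by (unfold level; lia).
    rewrite <- (Z.add_0_l (snd (value j) level)).
    replace (snd (value j) level) with (pN p level * snd (value j) level)
      by (rewrite Hl; apply Z.mul_1_l).
    rewrite wave_periodic by exact Hp. unfold wave.
    now rewrite Rmult_0_r, Rdiv_0_l.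
Qed.

Lemma riemann_re_phase_sum (N : nat) :
  riemann_re p a n x0 r N
  = (powerRZ (IZR p) r / IZR (pN p N) *
     phase_sum p (wave p level 1 0) (affine_value coef n shift dilation) N)%R.
Proof.
  unfold riemann_re, phase_sum. do 2 f_equal. apply map_ext. intros j.
  rewrite <- wave_value. fold (point j). fold (value j). ring.
Qed.

Lemma riemann_im_phase_sum (N : nat) :
  riemann_im p a n x0 r N
  = (powerRZ (IZR p) r / IZR (pN p N) *
     phase_sum p (wave p level 0 1) (affine_value coef n shift dilation) N)%R.
Proof.
  unfold riemann_im, phase_sum. do 2 f_equal. apply map_ext. intros j.
  rewrite <- wave_value. fold (point j). fold (value j). ring.
Qed.

Lemma normalized_phase_sum_const (u v : R) (N : nat) :
  (level <= N)%nat ->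
  (/ IZR (pN p N) * phase_sum p (wave p level u v) (affine_value coef n shift dilation) N)%R
  = (/ IZR (pN p level) *
     phase_sum p (wave p level u v) (affine_value coef n shift dilation) level)%R.
Proof.
  induction 1 as [|N HN IH]; [reflexivity |].
  rewrite <- IH.
  rewrite (PolynomialSums.phase_sumS Hp (phase_wave p level u v Hp) _ _ _ _ HN), pN_S, mult_IZR.
  pose proof (IZR_prime_gt_1 p Hp).
  assert (IZR (pN p N) <> 0%R) by (apply not_0_IZR; pose proof (pN_pos p N Hp); lia).
  field. split; [assumption | lra].
Qed.

(** The Riemann sums are constant from [N = level] on, so the limits are attained there. The bound
    is asked for all phases because the one used depends on the integral. *)
Lemma integral_bound (C : R) :
  (forall rho phi, phase p level rho phi ->
     Rabs (phase_sum p phi (affine_value coef n shift dilation) level)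
     <= rho * IZR (pN p level) * C)%R ->
  exists Ire Iim : R,
    Un_cv (riemann_re p a n x0 r) Ire /\
    Un_cv (riemann_im p a n x0 r) Iim /\
    (sqrt (Ire ^ 2 + Iim ^ 2) <= powerRZ (IZR p) r * C)%R.
Proof.
  intros HC.
  pose (S u v := phase_sum p (wave p level u v) (affine_value coef n shift dilation) level).
  pose (q := (powerRZ (IZR p) r / IZR (pN p level))%R).
  assert (HpN : (0 < IZR (pN p level))%R) by (apply IZR_lt, pN_pos, Hp).
  assert (Hpr : (0 < powerRZ (IZR p) r)%R)
    by (apply powerRZ_lt; pose proof (IZR_prime_gt_1 p Hp); lra).
  assert (Hq : (0 < q)%R) by (apply Rdiv_lt_0_compat; assumption).
  set (Ire := (q * S 1 0)%R). set (Iim := (q * S 0 1)%R).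
  exists Ire, Iim. split; [| split].
  - intros eps Heps. exists level. intros N HN.
    rewrite riemann_re_phase_sum. unfold Rdiv.
    rewrite Rmult_assoc, normalized_phase_sum_const by exact HN.
    unfold Ire, q, S, Rdiv. rewrite <- Rmult_assoc, Rdist_eq. exact Heps.
  - intros eps Heps. exists level. intros N HN.
    rewrite riemann_im_phase_sum. unfold Rdiv.
    rewrite Rmult_assoc, normalized_phase_sum_const by exact HN.
    unfold Iim, q, S, Rdiv. rewrite <- Rmult_assoc, Rdist_eq. exact Heps.
  - (* Testing against the phase in the direction of the integral itself
       turns the modulus into a single real sum. *)
    assert (Hlin : S Ire Iim = (Ire * S 1 0 + Iim * S 0 1)%R).
    { unfold S, phase_sum. rewrite <- Rsum_list_lin. f_equal. apply map_ext.
      intros j. unfold wave. ring. }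
    pose proof (HC _ _ (phase_wave p level Ire Iim Hp)) as Hb. fold (S Ire Iim) in Hb.
    set (rho := sqrt (Ire ^ 2 + Iim ^ 2)) in *.
    assert (Hrho : (rho * rho = q * S Ire Iim)%R).
    { unfold rho. rewrite sqrt_sqrt by nra. rewrite Hlin. unfold Ire at 1, Iim at 1.
      unfold Ire, Iim. ring. }
    assert (Hrho0 : (0 <= rho)%R) by apply sqrt_pos.
    pose proof (Rle_abs (S Ire Iim)) as Habs.
    assert (Hle : (rho * rho <= rho * (powerRZ (IZR p) r * C))%R).
    { rewrite Hrho.
      apply Rle_trans with (q * (rho * IZR (pN p level) * C))%R.
      - apply Rmult_le_compat_l; lra.
      - apply Req_le. unfold q. field. lra. }
    destruct (Rle_lt_or_eq_dec 0 rho Hrho0) as [Hpos | Hz].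
    + now apply Rmult_le_reg_l with rho.
    (* For a zero integral only [C >= 0] is left, which follows from the bound for the cosine. *)
    + rewrite <- Hz.
      specialize (HC _ _ (phase_wave p level 1 0 Hp)).
      replace (1 ^ 2 + 0 ^ 2)%R with 1%R in HC by ring. rewrite sqrt_1 in HC.
      pose proof (Rabs_pos (S 1 0)%R) as Habs1. fold (S 1 0)%R in HC.
      assert (0 <= C)%R.
      { apply (Rmult_le_reg_l (IZR (pN p level))); [exact HpN | lra]. }
      apply Rmult_le_pos; lra.
Qed.

End Angle.

(** * Valuations and the final estimate *)

Lemma coherent_mod_p (p : Z) (u : nat -> Z) (N : nat) :
  prime p -> coherent p u -> (1 <= N)%nat -> Zdiv.eqm p (u N) (u 1%nat).
Proof.
  intros Hp Hu. induction 1 as [|N HN IH]; [reflexivity |].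
  eapply eqm_trans; [| exact IH].
  destruct (Hu N) as [_ H]. rewrite H.
  pose proof (prime_ge_2 p Hp). pose proof (pN_pos p N Hp).
  apply Zmod_div_mod; [lia | lia |].
  destruct N as [|N]; [lia |]. rewrite pN_S. apply Z.divide_factor_l.
Qed.

Lemma Qp_unit (p : Z) (x : Qp p) (N : nat) :
  prime p -> Qp_nonzero x -> (1 <= N)%nat -> ~ (p | qu x N).
Proof.
  intros Hp [M HM] HN Hdiv. pose proof (prime_ge_2 p Hp).
  destruct (qu_norm _ x) as [H1 | H0]; [| now apply HM].
  pose proof (coherent_mod_p p (qu x) N Hp (qu_coh _ x) HN) as Hc.
  unfold Zdiv.eqm in Hc. rewrite (Zdivide_mod _ _ Hdiv) in Hc.
  destruct (qu_coh _ x 1%nat) as [Hr _]. unfold pN in Hr. rewrite Z.pow_1_r in Hr.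
  rewrite Z.mod_small in Hc by lia. congruence.
Qed.

Lemma Qabs_nonzero (p : Z) (x : Qp p) :
  Qp_nonzero x -> Qabs x = powerRZ (IZR p) (- qv x).
Proof.
  intros [M HM]. unfold Qabs. destruct (Z.eqb_spec (qu x 1%nat) 0) as [H0 | _]; [| reflexivity].
  destruct (qu_norm _ x) as [H1 | H]; [contradiction | now elim HM].
Qed.

Lemma prime_part (p : Z) (n : nat) :
  prime p -> (1 <= n)%nat ->
  exists (e : nat) (n' : Z), Z.of_nat n = pN p e * n' /\ ~ (p | n').
Proof.
  intros Hp. pose proof (prime_ge_2 p Hp).
  induction n as [n IH] using (well_founded_induction lt_wf). intros Hn.
  destruct (Zdivide_dec p (Z.of_nat n)) as [[q Hq] | Hnd].
  - assert (0 < q < Z.of_nat n) by nia.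
    destruct (IH (Z.to_nat q)) as (e & n' & He & Hn'); [lia | lia |].
    exists (S e), n'. split; [| exact Hn'].
    rewrite pN_S, Hq. rewrite Z2Nat.id in He by lia. rewrite He. ring.
  - exists 0%nat, (Z.of_nat n). split; [symmetry; apply Z.mul_1_l | exact Hnd].
Qed.

(** All follows from [2 ^ e <= p ^ e <= n]. The exception [p = n = 2] is absorbed by the factor 2 of
    the final bound. *)
Lemma prime_part_small (p : Z) (e n : nat) (n' : Z) :
  prime p -> (1 <= n)%nat -> Z.of_nat n = pN p e * n' ->
  (e < n)%nat /\ ((2 <= n)%nat -> (e + 2 <= n)%nat \/ (p = 2 /\ n = 2%nat /\ e = 1%nat)).
Proof.
  intros Hp Hn He. pose proof (prime_ge_2 p Hp) as Hp2. pose proof (pN_pos p e Hp).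
  assert (H2 : 2 ^ Z.of_nat e <= pN p e) by (apply Z.pow_le_mono_l; lia).
  assert (Hn'0 : 0 < n') by nia.
  assert (Hle : 2 ^ Z.of_nat e <= Z.of_nat n)
    by (pose proof (Z.le_mul_diag_r (pN p e) n'); lia).
  assert (Hlt : (e < n)%nat).
  { assert (Z.of_nat e < 2 ^ Z.of_nat e) by (apply Z.pow_gt_lin_r; lia). lia. }
  split; [exact Hlt |]. intros Hn2.
  destruct (le_lt_dec (e + 2) n) as [|Hbig]; [now left | right].
  assert (e = n - 1)%nat by lia. subst e.
  destruct n as [|[|[|n]]]; [lia | lia | |].
  - unfold pN in He. simpl in He. rewrite Z.pow_pos_fold, Z.pow_1_r in He.
    split; [| lia]. assert (0 < n') by nia. assert (n' = 1 \/ 2 <= n') by lia. nia.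
  - exfalso. replace (Z.of_nat (S (S (S n)) - 1)) with (Z.of_nat n + 2) in Hle by lia.
    rewrite Z.pow_add_r in Hle by lia. change (2 ^ 2) with 4 in Hle.
    assert (Z.of_nat n < 2 ^ Z.of_nat n) by (apply Z.pow_gt_lin_r; lia). lia.
Qed.

Lemma ndivide_prime_power (p u : Z) (v : nat) :
  prime p -> ~ (p | u) -> ~ (pN p (S v) | pN p v * u).
Proof.
  intros Hp Hu. rewrite pN_S, Z.mul_comm. intros H. apply Hu.
  apply Z.mul_divide_cancel_l in H; [exact H |].
  pose proof (pN_pos p v Hp). lia.
Qed.

(** The right side is [2 p ^ (n + w / n)]; when [p = 2] its factor 2 allows one more unit in [t]. *)
Lemma powerRZ_le_bound (p : Z) (n : nat) (t w : Z) :
  prime p -> (1 <= n)%nat ->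
  Z.of_nat n * t <= Z.of_nat n * Z.of_nat n + w \/
  (p = 2 /\ Z.of_nat n * t <= Z.of_nat n * Z.of_nat n + Z.of_nat n + w) ->
  (powerRZ (IZR p) t
   <= 2 * IZR p ^ n / Rpower (powerRZ (IZR p) (- w)) (/ INR n))%R.
Proof.
  intros Hp Hn Ht. pose proof (IZR_prime_gt_1 p Hp) as Hp1.
  assert (Hn0 : (0 < INR n)%R) by (apply lt_0_INR; lia).
  rewrite !powerRZ_Rpower by lra. rewrite Rpower_mult, opp_IZR.
  replace (- IZR w * / INR n)%R with (- (IZR w / INR n))%R by (field; lra).
  rewrite Rpower_Ropp. unfold Rdiv at 1. rewrite Rinv_inv.
  rewrite <- Rpower_pow by lra. rewrite Rmult_assoc, <- Rpower_plus.
  set (y := (INR n + IZR w / INR n)%R).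
  assert (Hy : (INR n * y = INR n * INR n + IZR w)%R) by (unfold y; field; lra).
  destruct Ht as [Ht | [H2 Ht]]; apply IZR_le in Ht;
    rewrite ?plus_IZR, ?mult_IZR, <- ?INR_IZR_INZ in Ht.
  - assert (Hty : (IZR t <= y)%R) by (apply Rmult_le_reg_l with (INR n); lra).
    pose proof (Rle_Rpower (IZR p) (IZR t) y (Rlt_le _ _ Hp1) Hty).
    assert (0 < Rpower (IZR p) y)%R by apply exp_pos. lra.
  - assert (Hty : (IZR t <= 1 + y)%R) by (apply Rmult_le_reg_l with (INR n); lra).
    pose proof (Rle_Rpower (IZR p) (IZR t) (1 + y) (Rlt_le _ _ Hp1) Hty) as H.
    rewrite Rpower_plus, Rpower_1 in H by lra. rewrite H2 in *. exact H.
Qed.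

Theorem mainTheorem3 (p : Z) (n : nat) (x0 : Qp p) (a : nat -> Qp p) (r : Z) :
  prime p -> (1 <= n)%nat -> Qp_nonzero (a n) ->
  exists Ire Iim : R,
    Un_cv (riemann_re p a n x0 r) Ire /\
    Un_cv (riemann_im p a n x0 r) Iim /\
    (sqrt (Ire ^ 2 + Iim ^ 2)
       <= 2 * IZR p ^ n / Rpower (Qabs (a n)) (/ INR n))%R.
Proof.
  intros Hp Hn Han.
  pose proof (IZR_prime_gt_1 p Hp) as Hp1.
  rewrite (Qabs_nonzero p (a n) Han).
  set (w := qv (a n)). set (K := level p n x0 a r).
  set (c := coef p n x0 a r). set (A := shift p n x0 a r). set (B := dilation p x0 r).
  assert (Hcrit : forall C : R,
    (forall rho phi, phase p K rho phi ->
       Rabs (phase_sum p phi (affine_value c n A B) K) <= rho * IZR (pN p K) * C)%R ->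
    (powerRZ (IZR p) r * C
       <= 2 * IZR p ^ n / Rpower (powerRZ (IZR p) (- w)) (/ INR n))%R ->
    exists Ire Iim : R,
      Un_cv (riemann_re p a n x0 r) Ire /\
      Un_cv (riemann_im p a n x0 r) Iim /\
      (sqrt (Ire ^ 2 + Iim ^ 2)
         <= 2 * IZR p ^ n / Rpower (powerRZ (IZR p) (- w)) (/ INR n))%R).
  { intros C HC Hle.
    destruct (integral_bound p Hp n x0 a r C HC) as (Ire & Iim & H1 & H2 & H3).
    exists Ire, Iim. split; [exact H1 | split; [exact H2 | lra]]. }
  (* Bounding the integrand by 1 gives [p ^ r], which suffices when [r <= n + w / n]. *)
  assert (Htrivial :
    Z.of_nat n * r <= Z.of_nat n * Z.of_nat n + w ->
    exists Ire Iim : R,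
      Un_cv (riemann_re p a n x0 r) Ire /\
      Un_cv (riemann_im p a n x0 r) Iim /\
      (sqrt (Ire ^ 2 + Iim ^ 2)
         <= 2 * IZR p ^ n / Rpower (powerRZ (IZR p) (- w)) (/ INR n))%R).
  { intros Hr. apply (Hcrit 1%R).
    - intros rho phi Hphi. rewrite IZR_pN, Rmult_1_r.
      apply (PolynomialSums.phase_sum_trivial Hp Hphi).
    - rewrite Rmult_1_r. apply powerRZ_le_bound; auto. }
  destruct (Z_le_gt_dec (Z.of_nat n * r) w) as [Hrw | Hrw]; [apply Htrivial; nia |].
  destruct (prime_part p n Hp Hn) as (e & n' & Hn' & Hpn').
  destruct (prime_part_small p e n n' Hp Hn Hn') as [Hen Hen2].
  assert (Hve : val_exp p n x0 a r <= 0) by apply reval_exp_le_0.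
  assert (Hvn : val_exp p n x0 a r <= w + Z.of_nat n * arg_exp p x0 r).
  { apply (reval_exp_le (fun i => qv (a i))). apply in_seq. lia. }
  assert (Hm : arg_exp p x0 r <= - r) by (unfold arg_exp; lia).
  assert (HK : Z.of_nat K = - val_exp p n x0 a r) by (unfold K, level; lia).
  (* The valuation of the leading coefficient [c n * B ^ n]: nonnegative by [Hvn] and [Hm], and
     below [K] because [n r > w]. *)
  set (s := Z.to_nat (Z.of_nat K + w - Z.of_nat n * r)).
  assert (Hs : Z.of_nat s = Z.of_nat K + w - Z.of_nat n * r) by (unfold s; nia).
  assert (HsK : (s < K)%nat) by lia.
  assert (Hlead : c n * B ^ Z.of_nat n = pN p s * qu (a n) K).
  { unfold c, B, coef, dilation, pN. fold K. fold w.
    rewrite <- Z.pow_mul_r by lia.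
    transitivity (p ^ (w + Z.of_nat n * arg_exp p x0 r - val_exp p n x0 a r)
                  * p ^ ((- r - arg_exp p x0 r) * Z.of_nat n) * qu (a n) K); [ring |].
    rewrite <- Z.pow_add_r by nia. do 2 f_equal. rewrite Hs, HK. ring. }
  assert (Hnd : ~ (pN p (S (s + e)) | Z.of_nat n * (c n * B ^ Z.of_nat n))).
  { rewrite Hlead, Hn'.
    replace (pN p e * n' * (pN p s * qu (a n) K))
      with (pN p (s + e) * (n' * qu (a n) K))
      by (unfold pN; rewrite Nat2Z.inj_add, Z.pow_add_r by lia; ring).
    apply ndivide_prime_power; [exact Hp |]. intros Hd.
    apply prime_mult in Hd; [| exact Hp]. destruct Hd as [Hd | Hd]; [now apply Hpn' |].
    revert Hd. apply Qp_unit; [exact Hp | exact Han | lia]. }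
  (* For [n = 1], [e = 0] and [s < K], so the integral vanishes. *)
  destruct (Nat.eq_dec n 1) as [Hn1 | Hn1].
  { apply (Hcrit 0%R).
    - intros rho phi Hphi.
      rewrite (PolynomialSums.phase_sum_linear Hp Hphi A (v := (s + e)%nat)); [| exact Hn1 | | lia | lia].
      + rewrite Rabs_R0. lra.
      + rewrite Hn1 in Hnd. change (Z.of_nat 1) with 1 in Hnd.
        now rewrite Z.mul_1_l, Z.pow_1_r in Hnd.
    - rewrite Rmult_0_r. apply Rlt_le.
      apply Rdiv_lt_0_compat; [| apply exp_pos].
      apply Rmult_lt_0_compat; [lra | apply pow_lt; lra]. }
  (* Here [n r - w = K - s <= e + 2 <= n + 1 <= n ^ 2]. *)
  destruct (le_lt_dec K (s + e + 2)) as [HKs | HKs].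
  { apply Htrivial. nia. }
  (* The largest [m] that the hypothesis of [phase_sum_bound] permits. *)
  set (m := ((K + n - (s + e + 3)) / n)%nat).
  assert (Hm1 : (n * m <= K + n - (s + e + 3))%nat) by (apply Nat.Div0.mul_div_le).
  assert (Hm2 : (K + n - (s + e + 3) < n * m + n)%nat).
  { unfold m. pose proof (Nat.mul_succ_div_gt (K + n - (s + e + 3)) n). lia. }
  apply (Hcrit (IZR p ^ Nat.pred n / IZR p ^ m)%R).
  - intros rho phi Hphi.
    assert (Hpm : (0 < IZR p ^ m)%R) by (apply pow_lt; lra).
    apply (Rmult_le_reg_r (IZR p ^ m)); [exact Hpm |].
    eapply Rle_trans.
    + apply (PolynomialSums.phase_sum_bound Hp Hphi A (v := (s + e)%nat)); [lia | lia | exact Hnd | lia].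
    + rewrite IZR_pN. apply Req_le. field. lra.
  - replace (powerRZ (IZR p) r * (IZR p ^ Nat.pred n / IZR p ^ m))%R
      with (powerRZ (IZR p) (r + Z.of_nat (Nat.pred n) - Z.of_nat m)).
    + apply powerRZ_le_bound; [exact Hp | exact Hn |].
      (* With [K - s = n r - w] this gives [n (r + n - 1 - m) <= n ^ 2 + w + (e + 2 - n)]; the last
         bracket is positive only for [p = n = 2], where it is 1. *)
      assert (Hm3 : Z.of_nat K - Z.of_nat (s + e + 2) <= Z.of_nat n * Z.of_nat m) by lia.
      rewrite Nat2Z.inj_pred by lia. unfold Z.pred.
      destruct (Hen2 ltac:(lia)) as [He | (H2 & Hn2 & He)].
      * left. lia.
      * right. split; [exact H2 |]. lia.
    + unfold Z.sub. rewrite !powerRZ_add, powerRZ_neg, <- !pow_powerRZ by lra.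
      rewrite pow_inv. unfold Rdiv. ring.
Qed.
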